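(* Let $V$ be a finite set, $v_0\notin V$, $d\geq 0$ an integer, and let $\mathscr{O}$ be an oriented matroid on the set of elements $V\sqcup\{v_0\}$ of rank at most $d$. Suppose that $\mathscr{M}$ is a matroid on the ground set $V$ such that $v_0\in\operatorname{conv}(U)$ for every $U\subseteq V$ with $\rho_{\mathscr{M}}(V-U)<d$. Then there exists an independent set $U'$ of $\mathscr{M}$ such that $v_0\in\operatorname{conv}(U')$.
   Context: Matroids: a matroid on a finite set $V$ is a nonempty family $\mathscr{M}$ of subsets of $V$ (its independent sets), closed under taking subsets, such that whenever $\sigma,\sigma'\in\mathscr{M}$ with $|\sigma|<|\sigma'|$ there is $v\in\sigma'-\sigma$ with $\sigma\cup\{v\}\in\mathscr{M}$. For $U\subseteq V$, $\rho_{\mathscr{M}}(U)$ is the maximal cardinality of an independent set contained in $U$. Oriented matroids: let $E$ be a finite set. A sign vector on $E$ is a function $\Phi\colon E\to\{-,0,+\}$; write $\Phi^{+}=\Phi^{-1}(+)$, $\Phi^{-}=\Phi^{-1}(-)$, $0$ for the all-zero sign vector, $-\Phi$ for the coordinatewise negation, $(\Phi\circ\Psi)(e)=\Phi(e)$ if $\Phi(e)\ne0$ and $\Psi(e)$ otherwise, and $S(\Phi,\Psi)=(\Phi^+\cap\Psi^-)\cup(\Phi^-\cap\Psi^+)$. An oriented matroid $\mathscr{O}$ on the set of elements $E$ is given by a set $\mathscr{L}(\mathscr{O})$ of sign vectors on $E$ (its covectors) such that: $0\in\mathscr{L}(\mathscr{O})$; $-\Phi\in\mathscr{L}(\mathscr{O})$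 iff $\Phi\in\mathscr{L}(\mathscr{O})$; $\Phi\circ\Psi\in\mathscr{L}(\mathscr{O})$ for all $\Phi,\Psi\in\mathscr{L}(\mathscr{O})$; and for all $\Pi,\Xi\in\mathscr{L}(\mathscr{O})$ and $v\in\Pi^+\cap\Xi^-$ there is $\Theta\in\mathscr{L}(\mathscr{O})$ with $\Theta(v)=0$ and $\Theta(w)=(\Pi\circ\Xi)(w)$ for all $w\in E-S(\Pi,\Xi)$. Two sign vectors $\Phi,\Psi$ are orthogonal if: there is $v$ with $\Phi(v)=\Psi(v)\neq0$ if and only if there is $w$ with $\Phi(w)=-\Psi(w)\neq0$. A vector of $\mathscr{O}$ is a sign vector orthogonal to every covector; $\mathscr{V}(\mathscr{O})$ is the set of vectors. The rank of $\mathscr{O}$ is the usual one: the maximal $k$ for which there is a chain $0<\Phi_1<\dots<\Phi_k$ in $\mathscr{L}(\mathscr{O})$ for the coordinatewise order induced by $0<-$, $0<+$ (with $-,+$ incomparable). For $U\subseteq E$, $\operatorname{conv}(U):=U\cup\{v\in E-U:\ \Phi^+\subseteq U\text{ and }\Phi^-=\{v\}\text{ for some }\Phi\in\mathscr{V}(\mathscr{O})\}$. *)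

(* Defs.v *)
From HB Require Import structures.
From mathcomp Require Import all_boot.

Set Implicit Arguments.
Unset Strict Implicit.
Unset Printing Implicit Defensive.

Record matroid (V : finType) := Matroid {
  indep : {set {set V}};
  indep_nonempty : indep != set0;
  indep_sub : forall S S' : {set V},
    S \subset S' -> S' \in indep -> S \in indep;
  indep_exchange : forall S S' : {set V},
    S \in indep -> S' \in indep -> #|S| < #|S'| ->
    exists2 v, v \in S' :\: S & v |: S \in indep
}.

Definition matroid_rank (V : finType) (M : matroid V) (U : {set V}) : nat :=
  \max_(S in indep M | S \subset U) #|S|.

Variant sign := SNeg | SZero | SPos.

Definition sign_to_option (s : sign) : option bool :=
  match s with SNeg => Some false | SZero => None | SPos => Some true end.
Definition option_to_sign (o : option bool) : sign :=
  match o with Some false => SNeg | None => SZero | Some true => SPos end.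
Lemma sign_to_optionK : cancel sign_to_option option_to_sign.
Proof. by case. Qed.
HB.instance Definition _ := Finite.copy sign (can_type sign_to_optionK).

Definition sign_opp (s : sign) : sign :=
  match s with SNeg => SPos | SZero => SZero | SPos => SNeg end.

Definition sign_le (s t : sign) : bool := (s == SZero) || (s == t).

Notation svect E := {ffun E -> sign}.

Section SignVectors.
Variable E : finType.

Implicit Types Phi Psi : svect E.

Definition sv_zero : svect E := [ffun=> SZero].
Definition sv_opp Phi : svect E := [ffun e => sign_opp (Phi e)].
Definition sv_pos Phi : {set E} := [set e | Phi e == SPos].
Definition sv_neg Phi : {set E} := [set e | Phi e == SNeg].
Definition sv_comp Phi Psi : svect E :=
  [ffun e => if Phi e != SZero then Phi e else Psi e].
Definition sv_sep Phi Psi : {set E} :=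
  (sv_pos Phi :&: sv_neg Psi) :|: (sv_neg Phi :&: sv_pos Psi).
Definition sv_lt Phi Psi : bool :=
  (Phi != Psi) && [forall e, sign_le (Phi e) (Psi e)].
Definition sv_orthogonal Phi Psi : bool :=
  [exists v, (Phi v == Psi v) && (Phi v != SZero)] ==
  [exists w, (Phi w == sign_opp (Psi w)) && (Phi w != SZero)].

End SignVectors.

Record oriented_matroid (E : finType) := OrientedMatroid {
  covectors : {set svect E};
  covectors0 : sv_zero E \in covectors;
  covectors_opp : forall Phi, (sv_opp Phi \in covectors) = (Phi \in covectors);
  covectors_comp : forall Phi Psi,
    Phi \in covectors -> Psi \in covectors -> sv_comp Phi Psi \in covectors;
  covectors_elim : forall (Pi Xi : svect E) (v : E),
    Pi \in covectors -> Xi \in covectors -> v \in sv_pos Pi :&: sv_neg Xi ->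
    exists Theta : svect E,
      [/\ Theta \in covectors, Theta v = SZero &
          forall w, w \notin sv_sep Pi Xi -> Theta w = sv_comp Pi Xi w]
}.

Section OrientedMatroid.
Variables (E : finType) (O : oriented_matroid E).

Definition om_vectors : {set svect E} :=
  [set Phi | [forall Psi in covectors O, sv_orthogonal Phi Psi]].

(* The maximal k admitting a chain 0 < Phi_1 < ... < Phi_k of covectors.  The
   bound k < #|covectors O| excludes no chain: 0, Phi_1, ..., Phi_k are k.+1
   distinct covectors. *)
Definition om_rank : nat :=
  \max_(k < #|covectors O| |
         [exists t : k.-tuple (svect E),
            all [in covectors O] t && path (@sv_lt E) (sv_zero E) t]) k.

Definition om_conv (U : {set E}) : {set E} :=
  U :|: [set v in ~: U | [exists Phi in om_vectors,
                            (sv_pos Phi \subset U) && (sv_neg Phi == [set v])]].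

End OrientedMatroid.

(* Main.v *)
Require Import Defs.
From mathcomp Require Import all_boot.
From mathcomp Require Import ssralg zmodp.

Set Implicit Arguments.
Unset Strict Implicit.
Unset Printing Implicit Defensive.

Import GRing.Theory.

(** Suppose that no independent set of M has v0 in its convex hull, and let Q
be the set of covectors that are negative at v0: the faces of an affine
arrangement of pseudohyperplanes.  By [farkas], every independent set S is
separated from v0 by a covector in Q that is nonnegative on S.  On the other
hand, for Phi in Q the set U where Phi is not negative cannot have v0 in its
convex hull ([conv_no_separation]), so the hypothesis makes the rank of M on the
negative part of Phi at least d.  These two facts contradict each other by a
fixed point argument.

The order complex of Q is contractible, of dimension at most d - 1 because the
rank of the oriented matroid is at most d.  To a chain of Q with top Phi attach
the complex of the independent sets contained in the negative part of Phi; it is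
a matroid complex of rank at least d, so it has no reduced homology below
dimension d - 1 ([matroid_exact]).  To a nonempty independent set S attach the
order complex of the covectors of Q that are not negative on all of S; they form
a union of half-spaces with a common point, which is contractible
([union_acyclic]).  Acyclic carriers then give maps from the order complex of Q
to the independence complex and back.  The composite is a self-map of a
contractible complex, so it has a fixed simplex ([carrier_coincidence]): a chain
with top Phi and an independent S contained in the negative part of Phi such that
Phi is not negative on all of S, which is absurd.

Everything happens on the level of simplicial chains over F_2, which needs no
orientations.  The empty set counts as a simplex, so that exactness is the
vanishing of reduced homology.  In place of the Lefschetz fixed point theorem
it is enough that a null-homotopic chain map has even trace
([nullhomotopic_trace]), whereas a fixed-point free map has trace 1, the
contribution of the empty simplex.

The regions of Q are handled without topology: a region cut out by sign
conditions is split along one pseudohyperplane at a time, covector elimination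
ensuring that the wall between two nonempty halves is nonempty, until it has a
largest covector; Mayer-Vietoris ([exact_union]) reassembles the pieces
([convex_acyclic]). *)

(** * Simplicial chains modulo two *)

Notation chain X := {ffun {set X} -> ('F_2)^o}.

Section Chains.
Local Open Scope ring_scope.
Variable X : finType.
Implicit Types (z w : chain X) (c t : {set X}) (K A B : {set {set X}}) (n : nat).

Lemma F2_addrr (a : 'F_2) : a + a = 0.
Proof. exact: (addrr_pchar2 (pchar_Fp (isT : prime 2))). Qed.

Lemma F2_oppr (a : 'F_2) : - a = a.
Proof. by apply/eqP; rewrite eq_sym -addr_eq0 F2_addrr. Qed.

Lemma chain_addrr z : z + z = 0.
Proof. by apply/ffunP=> c; rewrite !ffunE F2_addrr. Qed.

(** Each unordered pair is counted twice; this is why the square of the boundary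
    vanishes, both on chains and in the construction of carried maps. *)
Lemma sum_sym_pairs (V : zmodType) (V2 : forall v : V, v + v = 0)
    (c : {set X}) (f : X -> X -> V) :
  (forall x y, f x y = f y x) -> \sum_(x in c) \sum_(y in c :\ x) f x y = 0.
Proof.
move=> fC; (* an arbitrary linear order, to choose one representative of each pair *)
pose r (x y : X) := (enum_rank x < enum_rank y)%N.
pose S := \sum_(x in c) \sum_(y | (y \in c) && r x y) f x y.
suff -> : \sum_(x in c) \sum_(y in c :\ x) f x y = S + S by apply: V2.
have S_E : S = \sum_(x in c) \sum_(y | (y \in c) && r y x) f x y.
  rewrite /S (exchange_big_dep (mem c)) /=; last by move=> x y _ /andP[].
  by apply: eq_bigr => x cx; apply: eq_big => [y|y _]; [rewrite cx|apply: fC].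
rewrite {2}S_E -big_split; apply: eq_bigr => x cx.
rewrite (bigID (r x)) /=; congr (_ + _); apply: eq_bigl => y; rewrite !inE.
  by have [->|] := eqVneq y x; rewrite /r ?ltnn ?andbF.
rewrite /r -leqNgt ltn_neqAle; have [->|yx] := eqVneq y x; first by rewrite eqxx andbF.
by rewrite -[_ == _ :> nat]/(enum_rank y == enum_rank x) (inj_eq enum_rank_inj) yx.
Qed.

(** A facet-simplex incidence can be listed from the facet or from the simplex. *)
Lemma sum_incidences (V : zmodType) (F : {set X} -> {set X} -> V) :
  \sum_(t : {set X}) \sum_(x | x \notin t) F t (x |: t) =
  \sum_(c : {set X}) \sum_(x in c) F (c :\ x) c.
Proof.
rewrite (exchange_big_dep predT) //= [RHS](exchange_big_dep predT) //=.
apply: eq_bigr => x _.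
rewrite [RHS](reindex_onto (fun t => x |: t) (fun c => c :\ x)) /=; last first.
  by move=> c; apply: setD1K.
apply: eq_big => [t|t xt]; last by rewrite setU1K.
rewrite setU11 /=; have [xt|xt] := boolP (x \in t); last by rewrite setU1K ?eqxx.
by apply/esym/negbTE/eqP => tE; move: xt; rewrite -tE !inE eqxx.
Qed.

Definition boundary z : chain X := [ffun t : {set X} => \sum_(x | x \notin t) z (x |: t)].

Lemma boundaryD z w : boundary (z + w) = boundary z + boundary w.
Proof.
by apply/ffunP=> t; rewrite !ffunE -big_split; apply: eq_bigr => x _; rewrite ffunE.
Qed.

Lemma boundary0 : boundary 0 = 0.
Proof. by apply/ffunP=> t; rewrite !ffunE big1 // => x _; rewrite ffunE. Qed.

Lemma boundaryZ a z : boundary (a *: z) = a *: boundary z.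
Proof.
by apply/ffunP=> t; rewrite !ffunE scaler_sumr; apply: eq_bigr => x _; rewrite ffunE.
Qed.

Lemma boundary_sum (I : finType) (P : pred I) (F : I -> chain X) :
  boundary (\sum_(i | P i) F i) = \sum_(i | P i) boundary (F i).
Proof. exact: (big_morph _ boundaryD boundary0). Qed.

Lemma boundaryK z : boundary (boundary z) = 0.
Proof.
apply/ffunP=> t; rewrite !ffunE.
rewrite -[RHS](sum_sym_pairs F2_addrr (~: t) (f := fun x y => z (y |: (x |: t)))).
  apply: eq_big => [x|x xt]; rewrite ?inE // ffunE.
  by apply: eq_bigl => y; rewrite !inE negb_or.
by move=> x y; rewrite setUCA.
Qed.

Definition carried A z := [forall c, (c \notin A) ==> (z c == 0)].

Lemma carriedP A z : reflect (forall c, c \notin A -> z c = 0) (carried A z).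
Proof. by apply: (iffP forall_inP) => zA c /zA /eqP. Qed.

Lemma carriedS A B z : A \subset B -> carried A z -> carried B z.
Proof.
move=> /subsetP AB /carriedP zA; apply/carriedP => c cB; apply: zA.
by apply: contra cB => /AB.
Qed.

Lemma carriedD A z w : carried A z -> carried A w -> carried A (z + w).
Proof.
by move=> /carriedP zA /carriedP wA; apply/carriedP => c cA; rewrite ffunE zA ?wA ?addr0.
Qed.

Lemma carriedZ A a z : carried A z -> carried A (a *: z).
Proof. by move=> /carriedP zA; apply/carriedP => c cA; rewrite ffunE zA ?scaler0. Qed.

Lemma carried0 A : carried A 0.
Proof. by apply/carriedP => c _; rewrite ffunE. Qed.

Lemma carried_sum A (I : finType) (P : pred I) (F : I -> chain X) :
  (forall i, P i -> carried A (F i)) -> carried A (\sum_(i | P i) F i).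
Proof.
by move=> FA; apply: (big_ind (carried A)) => //; [apply: carried0|apply: carriedD].
Qed.

(** Closure under removing one vertex; [c :\ x] is [c] when [x] is not a vertex. *)
Definition complex K := forall c x, c \in K -> c :\ x \in K.

(** Simplices are graded by their number of vertices, one more than their
    dimension, so that the empty simplex sits in degree 0. *)
Definition skel n K := [set c in K | #|c| == n].

Lemma skelP n K c : reflect (c \in K /\ #|c| = n) (c \in skel n K).
Proof. by rewrite inE; apply: (iffP andP) => -[cK /eqP]. Qed.

Lemma skelS n A B : A \subset B -> skel n A \subset skel n B.
Proof.
move=> /subsetP AB; apply/subsetP => c /skelP[/AB cB cn].
by apply/skelP.
Qed.

Lemma carried_boundary K n z :
  complex K -> carried (skel n.+1 K) z -> carried (skel n K) (boundary z).
Proof.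
move=> cxK /carriedP zK; apply/carriedP => t tK; rewrite ffunE big1 // => x xt.
apply: zK; apply: contra tK => /skelP[xtK]; rewrite cardsU1 xt => -[xtn].
by apply/skelP; split=> //; rewrite -(setU1K xt); apply: cxK.
Qed.

Lemma boundary_skel0 K z : carried (skel 0 K) z -> boundary z = 0.
Proof.
move=> /carriedP zK; apply/ffunP=> t; rewrite !ffunE big1 // => x xt.
by apply: zK; apply/negP => /skelP[_]; rewrite cardsU1 xt.
Qed.

Definition empty_simplex : chain X := [ffun c : {set X} => (c == set0)%:R].

Lemma carried_empty_simplex K : set0 \in K -> carried (skel 0 K) empty_simplex.
Proof.
move=> K0; apply/carriedP => c cK; rewrite ffunE; case: eqP => // cE.
by case/skelP: cK; rewrite cE cards0.
Qed.

Lemma boundary_empty_simplex : boundary empty_simplex = 0.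
Proof. exact: boundary_skel0 (carried_empty_simplex (in_setT _)). Qed.

(** Vanishing of the reduced homology of [K] in dimension [n - 1]. *)
Definition exact_at K n := forall z, carried (skel n K) z -> boundary z = 0 ->
  exists2 w, carried (skel n.+1 K) w & boundary w = z.

Definition acyclic K := forall n, exact_at K n.

(** Coning a cycle over the apex [p] fills it; simplices that already contain [p]
    contribute nothing to the cone. *)
Lemma acyclic_cone K p : (forall c, c \in K -> p |: c \in K) -> acyclic K.
Proof.
move=> pK n z /carriedP zK dz0.
exists [ffun t : {set X} => if p \in t then z (t :\ p) else 0 : 'F_2].
  apply/carriedP => t tK; rewrite ffunE; case: ifP => // pt.
  apply: zK; apply: contra tK => /skelP[tpK tpn]; apply/skelP.
  by rewrite -(setD1K pt) pK // cardsU1 !inE eqxx tpn.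
apply/ffunP=> t; rewrite ffunE; have [pt|pt] := boolP (p \in t); last first.
  rewrite (bigD1 p) //= big1 => [|x /andP[xt xp]].
    by rewrite ffunE setU11 setU1K ?addr0.
  by rewrite ffunE !inE (negPf pt) eq_sym (negPf xp).
move/ffunP: dz0 => /(_ (t :\ p)); rewrite !ffunE (bigD1 p) /= ?setD1K ?inE ?eqxx //.
move/eqP; rewrite addr_eq0 => /eqP ->; rewrite -sumrN.
apply: eq_big => [x|x xt].
  by rewrite !inE; have [->|] := eqVneq x p; rewrite ?pt ?andbF ?andbT.
have xp : x != p by apply: contraNneq xt => ->.
rewrite ffunE !inE pt orbT F2_oppr; congr (z _); apply/setP=> y; rewrite !inE.
by have [->|] := eqVneq y p; rewrite ?(eq_sym p) ?(negPf xp) ?orbF ?andbF ?andbT /=.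
Qed.

(** Mayer-Vietoris: cut a cycle of the union into a part in [A] and a part in
    [B].  Their common boundary is a cycle of the intersection; filling it turns
    both parts into cycles, which can be filled separately.  In degree 0 the parts
    are already cycles, hence the form of the last hypothesis. *)
Lemma exact_union A B n : complex A -> complex B ->
    exact_at A n -> exact_at B n -> (forall m, n = m.+1 -> exact_at (A :&: B) m) ->
  exact_at (A :|: B) n.
Proof.
move=> cxA cxB exA exB exAB z zAB dz0.
pose a : chain X := [ffun c : {set X} => if c \in A then z c else 0].
have aA : carried (skel n A) a.
  apply/carriedP => c cA; rewrite ffunE; case: ifP => // Ac.
  apply: (carriedP _ _ zAB); apply: contra cA => /skelP[_ cn].
  exact/skelP.
have bB : carried (skel n B) (z + a).
  apply/carriedP => c cB; rewrite !ffunE; case: ifPn => [_|cA]; first exact: F2_addrr.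
  rewrite addr0; apply: (carriedP _ _ zAB); apply: contra cB => /skelP[].
  by rewrite inE (negPf cA) => cB cn; apply/skelP.
have dab : boundary (z + a) = boundary a by rewrite boundaryD dz0 add0r.
have [w [wA wB dw]] : exists w, [/\ carried (skel n A) w, carried (skel n B) w
                                  & boundary w = boundary a].
  case: n => [|m] in aA bB exAB zAB exA exB *.
    exists 0; rewrite boundary0 (boundary_skel0 aA).
    by split=> //; apply: carried0.
  have [||w wAB dw] := exAB m erefl (boundary a).
  - apply/carriedP => c; have /carriedP aAm := carried_boundary cxA aA.
    have /carriedP aBm := carried_boundary cxB bB.
    rewrite dab in aBm => cAB; have [cA|/aAm //] := boolP (c \in skel m A).
    apply: aBm; apply: contra cAB => /skelP[cB cm]; apply/skelP; split=> //.
    by rewrite inE cB; case/skelP: cA => ->.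
  - exact: boundaryK.
  exists w; split=> //; apply: carriedS wAB; apply: skelS; [exact: subsetIl|exact: subsetIr].
have [||u uA du] := exA (a + w); [exact: carriedD|by rewrite boundaryD dw chain_addrr|].
have [||v vB dv] := exB (z + a + w); first exact: carriedD.
  by rewrite boundaryD dw dab chain_addrr.
exists (u + v); last first.
  rewrite boundaryD du dv addrC -addrA (addrC a) (addrA w) chain_addrr add0r.
  by rewrite -addrA chain_addrr addr0.
by apply: carriedD; [apply: carriedS uA|apply: carriedS vB]; apply: skelS;
  [apply: subsetUl|apply: subsetUr].
Qed.

Lemma acyclic_union A B : complex A -> complex B ->
  acyclic A -> acyclic B -> acyclic (A :&: B) -> acyclic (A :|: B).
Proof.
by move=> cxA cxB aA aB aAB n; apply: exact_union => // m _; apply: aAB.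
Qed.

(** The trace of [boundary \o N] and that of [N \o boundary] both count the
    incidences of a facet with a simplex, weighted by the same coefficients of
    [N], so they cancel modulo two. *)
Lemma nullhomotopic_trace K (N T : {set X} -> chain X) : complex K ->
    (forall c, c \in K -> carried K (N c)) ->
    (forall c, c \in K -> T c = boundary (N c) + \sum_(x in c) N (c :\ x)) ->
  \sum_(c in K) T c c = 0.
Proof.
move=> cxK NK TE.
(* [N] is meaningless outside [K], so its coefficients there are masked *)
pose F c t := if t \in K then N c t else 0.
have dF c : c \in K -> \sum_(x | x \notin c) F c (x |: c) = boundary (N c) c.
  move=> cK; rewrite ffunE; apply: eq_bigr => x xc; rewrite /F; case: ifPn => // xcK.
  by rewrite (carriedP _ _ (NK c cK)).
under eq_bigr => c cK do rewrite TE // ffunE -dF // sum_ffunE.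
rewrite big_split /= [X in X + _](_ : _ = \sum_(c : {set X}) \sum_(x | x \notin c) F c (x |: c)).
  rewrite sum_incidences [X in X + _](_ : _ = \sum_(c in K) \sum_(x in c) N (c :\ x) c).
    exact: F2_addrr.
  rewrite [RHS]big_mkcond; apply: eq_bigr => c _; rewrite /F.
  by case: ifP => // _; rewrite big1.
rewrite big_mkcond; apply: eq_bigr => c _; case: ifPn => // cK.
rewrite big1 // => x xc; rewrite /F; case: ifP => // xcK.
by case/negP: cK; rewrite -(setU1K xc); apply: cxK.
Qed.

End Chains.

(** * Acyclic carriers and coincidences *)

Section Carriers.
Local Open Scope ring_scope.
Variables X Y : finType.

(** The inhomogeneous term [b] makes one recursion serve two purposes: with
    [b = 0] and [k = 0] the function [f] is a chain map, and with [k = 1] it is a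
    homotopy between the chain map [b] and zero.  The values on simplices of
    size [n + 1] exist because the prescribed boundary is a cycle in the
    carrier. *)
Lemma acyclic_carrier (K : {set {set X}}) (A : {set X} -> {set {set Y}}) (k : nat)
    (b : {set X} -> chain Y) (f0 : chain Y) :
    complex K -> (forall c x, c \in K -> A (c :\ x) \subset A c) ->
    carried (skel k (A set0)) f0 -> boundary f0 = b set0 ->
    (forall c, c \in K -> boundary (b c) = \sum_(x in c) b (c :\ x)) ->
    (forall c n, c \in K -> #|c| = n.+1 -> carried (skel (n + k) (A c)) (b c)) ->
    (forall c n, c \in K -> #|c| = n.+1 -> exact_at (A c) (n + k)) ->
  exists f : {set X} -> chain Y, f set0 = f0 /\ forall c, c \in K ->
    carried (skel (#|c| + k) (A c)) (f c) /\
    boundary (f c) = \sum_(x in c) f (c :\ x) + b c.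
Proof.
move=> cxK AS f0A df0 db bA exA.
pose good (f : {set X} -> chain Y) (c : {set X}) := carried (skel (#|c| + k) (A c)) (f c) /\
    boundary (f c) = \sum_(x in c) f (c :\ x) + b c.
suff H n : exists f : {set X} -> chain Y, f set0 = f0 /\
    forall c : {set X}, c \in K -> (#|c| <= n)%N -> good f c.
  have [f [f0E fP]] := H #|X|; exists f; split=> // c cK; apply: fP => //; exact: max_card.
elim: n => [|n [f [f0E fP]]].
  exists (fun=> f0); split=> // c _; rewrite leqn0 cards_eq0 => /eqP ->.
  by rewrite /good cards0 big_set0 add0r.
pose z (c : {set X}) : chain Y := \sum_(x in c) f (c :\ x) + b c.
pose f' (c : {set X}) : chain Y := if #|c| == n.+1 then
    odflt 0 [pick w | carried (skel (n.+1 + k) (A c)) w && (boundary w == z c)] else f c.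
exists f'; split; first by rewrite /f' cards0.
have f'E (c : {set X}) : (#|c| <= n)%N -> f' c = f c.
  by move=> cn; rewrite /f' ltn_eqF.
move=> c cK; rewrite leq_eqVlt => /orP[/eqP cn|cn]; last first.
  rewrite /good f'E // (eq_bigr (fun x => f (c :\ x))); first exact: fP.
  by move=> x xc; rewrite f'E // -ltnS (leq_ltn_trans _ cn) // subset_leq_card ?subsetDl.
have cx x : x \in c -> #|c :\ x| = n.
  by move=> xc; apply/eqP; rewrite -eqSS -cn (cardsD1 x c) xc.
rewrite /good (eq_bigr (fun x => f (c :\ x))) => [|x xc]; last by rewrite f'E // cx.
rewrite -/(z c) /f' cn eqxx; case: pickP => [w /andP[wA /eqP //]|no].
have [||w wA dw] := exA c n cK cn (z c).
- apply: carriedD; last exact: bA.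
  apply: carried_sum => x xc; have [] := fP (c :\ x) (cxK _ _ cK); first by rewrite cx.
  by rewrite cx // => fA _; apply: carriedS fA; apply/skelS/AS.
- rewrite boundaryD boundary_sum db //.
  rewrite (eq_bigr (fun x => \sum_(y in c :\ x) f (c :\ x :\ y) + b (c :\ x))); last first.
    by move=> x xc; have [] := fP (c :\ x) (cxK _ _ cK) _; rewrite ?cx.
  rewrite big_split /= (sum_sym_pairs (@chain_addrr Y)) ?add0r ?chain_addrr // => x y.
  by congr f; apply/setP=> u; rewrite !inE andbCA.
by have := no w; rewrite wA dw eqxx.
Qed.

Definition extend (h : {set X} -> chain Y) (z : chain X) : chain Y :=
  \sum_(c : {set X}) z c *: h c.

Lemma boundary_extend K (h : {set X} -> chain Y) z : carried K z ->
    (forall c, c \in K -> boundary (h c) = \sum_(x in c) h (c :\ x)) ->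
  boundary (extend h z) = extend h (boundary z).
Proof.
move=> /carriedP zK dh; rewrite boundary_sum.
rewrite (eq_bigr (fun c : {set X} => \sum_(x in c) z c *: h (c :\ x))); last first.
  move=> c _; rewrite boundaryZ -scaler_sumr.
  by have [/dh ->//|/zK ->] := boolP (c \in K); rewrite !scale0r.
rewrite -(sum_incidences (fun t c => z c *: h t)); apply: eq_bigr => t _.
by rewrite ffunE scaler_suml.
Qed.

End Carriers.

Section Coincidence.
Local Open Scope ring_scope.
Variables X Y : finType.

(** A fixed point theorem for a pair of set-valued maps [A] and [B] with acyclic
    values: if no simplex [c] met its own image, the composite of chain maps
    carried by [A] and [B] would have trace 1, from the empty simplex alone,
    although it is null-homotopic because [K] is acyclic.  The values [A c] need
    to be exact only in the degree in which the boundary of [c] must be filled. *)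
Lemma carrier_coincidence (K : {set {set X}}) (L : {set {set Y}})
    (A : {set X} -> {set {set Y}}) (B : {set Y} -> {set {set X}}) :
    complex K -> set0 \in K -> acyclic K -> complex L ->
    (forall c, c \in K -> A c \subset L) ->
    (forall c x, c \in K -> A (c :\ x) \subset A c) -> set0 \in A set0 ->
    (forall c n, c \in K -> #|c| = n.+1 -> exact_at (A c) n) ->
    (forall S, S \in L -> B S \subset K) ->
    (forall S y, S \in L -> B (S :\ y) \subset B S) -> set0 \in B set0 ->
    (forall S, S \in L -> S != set0 -> acyclic (B S)) ->
  exists c S, [/\ c \in K, c != set0, S \in A c & c \in B S].
Proof.
move=> cxK K0 exK cxL AL AS A0 exA BK BS B0 exB.
have [/exists_inP[c cK /existsP[S /and3P[c0 SA cB]]]|] := boolP [exists c in K,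
    [exists S : {set Y}, [&& c != set0, S \in A c & c \in B S]]].
  by exists c, S.
rewrite negb_exists_in => /forall_inP noS; exfalso.
have [g [g0 gP]] : exists g : {set X} -> chain Y,
    g set0 = empty_simplex Y /\ forall c, c \in K ->
      carried (skel (#|c| + 0) (A c)) (g c) /\
      boundary (g c) = \sum_(x in c) g (c :\ x) + 0.
  apply: (@acyclic_carrier _ _ K A 0 (fun=> 0)) => //.
  - exact: carried_empty_simplex.
  - exact: boundary_empty_simplex.
  - by move=> c _; rewrite boundary0 big1.
  - by move=> *; apply: carried0.
  - by move=> c n cK cn; rewrite addn0; apply: exA.
have [h [h0 hP]] : exists h : {set Y} -> chain X,
    h set0 = empty_simplex X /\ forall S, S \in L ->
      carried (skel (#|S| + 0) (B S)) (h S) /\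
      boundary (h S) = \sum_(v in S) h (S :\ v) + 0.
  apply: (@acyclic_carrier _ _ L B 0 (fun=> 0)) => //.
  - exact: carried_empty_simplex.
  - exact: boundary_empty_simplex.
  - by move=> c _; rewrite boundary0 big1.
  - by move=> *; apply: carried0.
  - by move=> S n SL Sn; apply: exB; rewrite -?card_gt0 ?Sn.
pose T (c : {set X}) := extend h (g c).
have T0 : T set0 = empty_simplex X.
  rewrite /T g0 /extend (bigD1 set0) //= big1 => [|S S0].
    by rewrite ffunE eqxx scale1r addr0 h0.
  by rewrite ffunE (negPf S0) scale0r.
have gL c : c \in K -> carried L (g c).
  move=> cK; have [gc _] := gP c cK; apply: carriedS gc; apply/subsetP => S /skelP[SA _].
  exact: (subsetP (AL c cK)).
have dT c : c \in K -> boundary (T c) = \sum_(x in c) T (c :\ x).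
  move=> cK; rewrite /T (boundary_extend (gL c cK)); last first.
    by move=> S /hP[_ ->]; rewrite addr0.
  have [_ ->] := gP c cK; rewrite addr0 /extend.
  rewrite exchange_big /=; apply: eq_bigr => S _.
  by rewrite sum_ffunE scaler_suml.
have T_carried c n : c \in K -> #|c| = n -> carried (skel n K) (T c).
  move=> cK cn; apply: carried_sum => S _; have [gc _] := gP c cK.
  have [|/(carriedP _ _ gc) ->] := boolP (S \in skel (#|c| + 0) (A c)); last first.
    by rewrite scale0r carried0.
  rewrite addn0 cn => /skelP[/(subsetP (AL c cK)) SL Sn]; apply: carriedZ.
  have [hS _] := hP S SL; move: hS; rewrite Sn addn0; apply: carriedS.
  exact/skelS/BK.
have [N0 N0K dN0] := exK 0%N _ (carried_empty_simplex K0) (boundary_empty_simplex X).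
have [N [_ NP]] : exists N : {set X} -> chain X,
    N set0 = N0 /\ forall c, c \in K ->
      carried (skel (#|c| + 1) K) (N c) /\
      boundary (N c) = \sum_(x in c) N (c :\ x) + T c.
  apply: (@acyclic_carrier _ _ K (fun=> K) 1 T) => //.
  - by rewrite T0.
  - by move=> c n cK cn; rewrite addn1; apply: T_carried.
have : \sum_(c in K) T c c = 0.
  apply: (@nullhomotopic_trace _ _ N T cxK) => c /NP[Nc dN]; last first.
    by rewrite dN addrAC chain_addrr add0r.
  by apply: carriedS Nc; apply/subsetP => c' /skelP[].
(* off the empty simplex, a nonzero diagonal coefficient would be a coincidence *)
rewrite (bigD1 set0) //= T0 ffunE eqxx big1 => [/eqP|].
  by rewrite addr0 oner_eq0.
move=> c /andP[cK c0]; rewrite sum_ffunE big1 // => S _; rewrite ffunE.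
have [gc _] := gP c cK.
have [/skelP[SA _]|/(carriedP _ _ gc) ->] := boolP (S \in skel (#|c| + 0) (A c)); last first.
  by rewrite scale0r.
have [hS _] := hP S (subsetP (AL c cK) S SA).
rewrite (carriedP _ _ hS) ?scaler0 //; apply/negP => /skelP[cB _].
by have /existsP[] := noS c cK; exists S; rewrite c0 SA.
Qed.

End Coincidence.

(** * Matroid complexes *)

Section MatroidComplex.
Variable V : finType.
Implicit Types (K : {set {set V}}) (B S W : {set V}) (v : V).

Definition down_closed K := forall S S' : {set V}, S \subset S' -> S' \in K -> S \in K.

Definition exchange K := forall S S' : {set V}, S \in K -> S' \in K -> #|S| < #|S'| ->
  exists2 v, v \in S' :\: S & v |: S \in K.

Lemma down_closed_complex K : down_closed K -> complex K.
Proof. by move=> dK c x; apply: dK; apply: subsetDl. Qed.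

Lemma exchange_extend K S B : exchange K -> S \in K -> B \in K ->
  exists2 S', S' \in K & (S \subset S') && (#|B| <= #|S'|).
Proof.
move=> eK SK BK; pose P S' := (S' \in K) && (S \subset S').
have PS : P S by rewrite /P SK subxx.
have [S' /andP[S'K SS'] S'max] := @arg_maxnP _ S P (fun S' => #|S'|) PS.
exists S' => //; rewrite SS' leqNgt; apply/negP => ltS'B.
have [v] := eK _ _ S'K BK ltS'B; rewrite inE => /andP[vS' _] vK.
have := S'max (v |: S'); rewrite /P vK (subset_trans SS') ?subsetUr //= => /(_ isT).
by rewrite cardsU1 vS' ltnn.
Qed.

(** If the independent sets are all the subsets of [B], they form a cone.
    Otherwise some vertex [v] lies outside [B]; the complex is the union of the
    deletion of [v], which still contains [B], and of the star of [v], a cone.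
    They meet in the link of [v], a matroid complex whose rank drops by at most
    one, as [v] can be completed to an independent set at least as large as [B]. *)
Lemma matroid_exact K B n : down_closed K -> exchange K -> B \in K -> n < #|B| ->
  exact_at K n.
Proof.
have [m] := ubnP #|cover K|; elim: m => // m IH in K B n *; rewrite ltnS => Km dK eK BK nB.
have cxK := down_closed_complex dK.
have [KB|] := boolP [forall S in K, S \subset B].
  have /card_gt0P[p pB] : 0 < #|B| by apply: leq_ltn_trans nB.
  apply: (@acyclic_cone _ _ p) => S /(forall_inP KB) SB.
  by apply: dK BK; rewrite subUset sub1set pB.
case/forall_inPn => S SK /subsetPn[v vS vB].
have vK : [set v] \in K by apply: dK SK; rewrite sub1set.
pose D := [set S in K | v \notin S]; pose St := [set S in K | v |: S \in K].
have DE : {subset D <= K} by move=> S'; rewrite inE => /andP[].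
have KE : K = D :|: St.
  apply/setP=> S'; rewrite !inE; have [S'K|//] := boolP (S' \in K).
  by have [vS'|//] := boolP (v \in S'); rewrite (setUidPr _) ?sub1set.
have cxD : complex D.
  by move=> c x; rewrite !inE => /andP[/cxK -> vc]; rewrite (negPf vc) andbF.
have dSt : down_closed St.
  move=> S1 S2 S12; rewrite !inE => /andP[S2K vS2]; rewrite (dK _ _ S12 S2K) /=.
  by apply: dK vS2; apply: setUS.
(* the number of vertices used drops since [v] is lost *)
have cover_lt (L : {set {set V}}) : {subset L <= D} -> #|cover L| < m.
  move=> LD; apply: leq_trans Km; apply: proper_card; apply/properP; split.
    apply/bigcupsP => S' /LD /DE S'K; exact: bigcup_sup.
  exists v; first by apply/bigcupP; exists S.
  by apply/bigcupP => -[S' /LD]; rewrite inE => /andP[_ /negPf ->].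
rewrite KE; apply: exact_union => //; first exact: down_closed_complex.
- apply: (IH D B) => //; first exact: cover_lt.
  + move=> S1 S2 S12; rewrite !inE => /andP[S2K vS2]; rewrite (dK _ _ S12 S2K) /=.
    by apply: contra vS2; apply: (subsetP S12).
  + move=> S1 S2; rewrite !inE => /andP[S1K vS1] /andP[S2K vS2] ltS.
    have [u uS uK] := eK _ _ S1K S2K ltS; exists u => //; rewrite !inE uK negb_or vS1 andbT.
    by apply: contraNneq vS2 => ->; move: uS; rewrite inE => /andP[].
  + by rewrite inE BK.
- apply: (@acyclic_cone _ _ v) => S'; rewrite !inE => /andP[_ vS'].
  by rewrite vS' setUA setUid.
move=> k nk; have [B' B'K /andP[]] := exchange_extend eK vK BK.
rewrite sub1set => vB' BB'.
apply: (IH (D :&: St) (B' :\ v)).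
- by apply: cover_lt => S'; rewrite inE => /andP[].
- move=> S1 S2 S12; rewrite !in_setI => /andP[S2D S2St]; rewrite (dSt _ _ S12 S2St) andbT.
  move: S2D; rewrite !inE => /andP[S2K vS2]; rewrite (dK _ _ S12 S2K) /=.
  by apply: contra vS2; apply: (subsetP S12).
- move=> S1 S2; rewrite !inE => /andP[/andP[_ vS1] /andP[_ S1K]].
  move=> /andP[/andP[_ vS2] /andP[_ S2K]] ltS.
  have [|u uS uK] := eK _ _ S1K S2K; first by rewrite !cardsU1 vS1 vS2 ltnS.
  have {uS} /and3P[uv uS1 uS2] : [&& u != v, u \notin S1 & u \in S2].
    by move: uS; rewrite !inE negb_or -andbA; case: eqP.
  exists u; first by rewrite inE uS1.
  rewrite setUCA in uK; rewrite !inE uK (dK _ _ (subsetUr _ _) uK) negb_or vS1.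
  by rewrite eq_sym uv.
- by rewrite !inE eqxx setD1K // B'K !andbT (dK _ _ (subsetDl _ _) B'K).
by have := leq_trans nB BB'; rewrite nk (cardsD1 v B') vB'.
Qed.
End MatroidComplex.

(** * Order complexes *)

Section OrderComplex.
Variables (T : finType) (le : rel T).
Hypotheses (le_refl : reflexive le) (le_trans : transitive le).
Implicit Types (R A B c : {set T}).

Definition order_complex R : {set {set T}} :=
  [set c : {set T} | (c \subset R) && [forall x in c, forall y in c, le x y || le y x]].

Lemma order_complexP R c :
  reflect (c \subset R /\ {in c &, total le}) (c \in order_complex R).
Proof.
rewrite inE; apply: (iffP andP) => -[cR tot]; split=> //.
  by move=> x y xc yc; have /forall_inP/(_ y yc) := forall_inP tot x xc.
by apply/forall_inP=> x xc; apply/forall_inP=> y yc; apply: tot.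
Qed.

Lemma order_complex_complex R : complex (order_complex R).
Proof.
move=> c x /order_complexP[cR tot]; apply/order_complexP; split.
  exact: subset_trans (subsetDl _ _) cR.
by move=> y z /setD1P[_ yc] /setD1P[_ zc]; apply: tot.
Qed.

Lemma order_complexS A B : A \subset B -> order_complex A \subset order_complex B.
Proof.
move=> AB; apply/subsetP => c /order_complexP[cA tot]; apply/order_complexP; split=> //.
exact: subset_trans AB.
Qed.

Lemma chain_has_max R c : c \in order_complex R -> c != set0 ->
  exists2 x, x \in c & {in c, forall y, le y x}.
Proof.
move=> /order_complexP[_ tot] /set0Pn[x0 x0c].
have [x xc xmax] := @arg_maxnP _ x0 (mem c) (fun x => #|[set y in c | le y x]|) x0c.
exists x => // y yc; have [//|xy] := orP (tot _ _ yc xc).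
have sub : [set z in c | le z x] \subset [set z in c | le z y].
  by apply/subsetP => z; rewrite !inE => /andP[-> /le_trans ->].
have : [set z in c | le z x] == [set z in c | le z y].
  by rewrite eqEcard sub; apply: xmax.
by move/eqP/setP/(_ y); rewrite !inE yc le_refl.
Qed.

Lemma order_complexI A B :
  order_complex (A :&: B) = order_complex A :&: order_complex B.
Proof. by apply/setP=> c; rewrite !inE subsetI andbACA andbb. Qed.

(** The maximum of a chain decides in which of two down-closed parts the whole
    chain lies. *)
Lemma order_complexU A B :
    (forall x y, x \in A -> y \in A :|: B -> le y x -> y \in A) ->
    (forall x y, x \in B -> y \in A :|: B -> le y x -> y \in B) ->
  order_complex (A :|: B) = order_complex A :|: order_complex B.
Proof.
move=> dA dB; apply/setP=> c; apply/idP/setUP => [cAB|[]]; last 2 first.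
- exact/subsetP/order_complexS/subsetUl.
- exact/subsetP/order_complexS/subsetUr.
have [c0|c0] := eqVneq c set0.
  by left; apply/order_complexP; rewrite c0 sub0set; split=> // x y; rewrite inE.
have [x xc xmax] := chain_has_max cAB c0.
have /order_complexP[/subsetP sAB tot] := cAB.
by have /setUP[xA|xB] := sAB x xc; [left|right]; apply/order_complexP; split=> //;
  apply/subsetP => y yc; [apply: dA xA _ _|apply: dB xB _ _]; rewrite ?xmax ?sAB.
Qed.

Lemma order_complex_cone R p : p \in R -> {in R, forall x, le x p} ->
  acyclic (order_complex R).
Proof.
move=> pR pmax; apply: (@acyclic_cone _ _ p) => c /order_complexP[cR tot].
apply/order_complexP; split; first by rewrite subUset sub1set pR.
have cp x : x \in c -> le x p by move=> xc; apply/pmax/(subsetP cR).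
move=> x y /setU1P[->|xc] /setU1P[->|yc]; rewrite ?le_refl ?cp ?orbT //.
exact: tot.
Qed.

End OrderComplex.

(** * Regions of sign vectors *)

Section SignVectorRegions.
Variable E : finType.
Implicit Types (Phi Psi Pi Xi : svect E) (e : E) (R : {set svect E}).

Definition sv_le Phi Psi := [forall e, sign_le (Phi e) (Psi e)].

Lemma sv_le_refl : reflexive sv_le.
Proof. by move=> Phi; apply/forallP => e; rewrite /sign_le eqxx orbT. Qed.

Lemma sv_le_trans : transitive sv_le.
Proof.
move=> Psi Phi Pi /forallP le1 /forallP le2; apply/forallP => e.
by move: (le1 e) (le2 e); case: (Phi e) (Psi e) (Pi e) => -[] [].
Qed.

Local Notation Delta := (order_complex sv_le).

(** Composition and elimination both restrict to closed half-spaces; together they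
    play the part of geometric convexity for sets of faces of an arrangement. *)
Definition convex R :=
  {in R &, forall Phi Psi, sv_comp Phi Psi \in R} /\
  forall Pi Xi e, Pi \in R -> Xi \in R -> Pi e = SPos -> Xi e = SNeg ->
    exists Theta : svect E, [/\ Theta \in R, Theta e = SZero &
      forall w, w \notin sv_sep Pi Xi -> Theta w = sv_comp Pi Xi w].

Definition nonneg e : {set svect E} := [set Phi : svect E | Phi e != SNeg].
Definition nonpos e : {set svect E} := [set Phi : svect E | Phi e != SPos].

Lemma convex_face R e s : convex R -> s != SZero ->
  convex [set Phi : svect E in R | Phi e != s].
Proof.
move=> [compR elimR] s0; split=> [Phi Psi|Pi Xi v].
  rewrite !inE => /andP[PhiR Phie] /andP[PsiR Psie]; rewrite compR // ffunE.
  by case: ifP.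
rewrite !inE => /andP[PiR Pie] /andP[XiR Xie] Piv Xiv.
have [Theta [ThR Thv Thw]] := elimR _ _ _ PiR XiR Piv Xiv.
exists Theta; split=> //; rewrite !inE ThR /=; have [esep|esep] := boolP (e \in sv_sep Pi Xi).
  by move: esep Pie Xie; rewrite !inE; case: s s0 => // _; case: (Pi e); case: (Xi e).
by rewrite Thw // ffunE; case: ifP.
Qed.

Lemma convex_nonneg R e : convex R -> convex (R :&: nonneg e).
Proof.
move=> cR; rewrite (_ : _ :&: _ = [set Phi : svect E in R | Phi e != SNeg]).
  exact: convex_face.
by apply/setP=> Phi; rewrite !inE.
Qed.

Lemma convex_nonpos R e : convex R -> convex (R :&: nonpos e).
Proof.
move=> cR; rewrite (_ : _ :&: _ = [set Phi : svect E in R | Phi e != SPos]).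
  exact: convex_face.
by apply/setP=> Phi; rewrite !inE.
Qed.

Lemma nonneg_down e : forall Phi Psi, Phi \in nonneg e -> sv_le Psi Phi -> Psi \in nonneg e.
Proof.
move=> Phi Psi; rewrite !inE => Phie /forallP/(_ e); rewrite /sign_le.
by case/orP => /eqP ->.
Qed.

Lemma nonpos_down e : forall Phi Psi, Phi \in nonpos e -> sv_le Psi Phi -> Psi \in nonpos e.
Proof.
move=> Phi Psi; rewrite !inE => Phie /forallP/(_ e); rewrite /sign_le.
by case/orP => /eqP ->.
Qed.

Definition two_sided R e :=
  [exists Phi : svect E in R, Phi e == SPos] && [exists Phi : svect E in R, Phi e == SNeg].

(** When no pseudohyperplane separates two members, composing never meets
    conflicting signs, so a member of largest support lies above all the others:
    it plays the part of the interior of a closed cell. *)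
Lemma one_sided_max R : convex R -> R != set0 -> (forall e, ~~ two_sided R e) ->
  exists2 Phi, Phi \in R & {in R, forall Psi, sv_le Psi Phi}.
Proof.
move=> [compR _] /set0Pn[Phi0 Phi0R] one.
pose supp (Phi : svect E) := [set e | Phi e != SZero].
have [Phi PhiR Phimax] := @arg_maxnP _ Phi0 (mem R) (fun Phi => #|supp Phi|) Phi0R.
exists Phi => // Psi PsiR; apply/forallP => e; rewrite /sign_le.
have [//|Psie] := eqVneq (Psi e) SZero.
have sub : supp Phi \subset supp (sv_comp Phi Psi).
  by apply/subsetP => v; rewrite !inE ffunE => Phiv; rewrite Phiv.
have : supp Phi == supp (sv_comp Phi Psi).
  by rewrite eqEcard sub; apply: Phimax; apply: compR.
move/eqP/setP/(_ e); rewrite !inE ffunE.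
case Phie : (Phi e); rewrite ?eqxx ?Psie //= => _; last first.
  case Psie' : (Psi e) Psie => // _; case/andP: (one e).
  by split; apply/exists_inP; [exists Phi|exists Psi]; rewrite ?Phie ?Psie'.
case Psie' : (Psi e) Psie => // _; case/andP: (one e).
by split; apply/exists_inP; [exists Psi|exists Phi]; rewrite ?Phie ?Psie'.
Qed.

(** Cut along an element [e] on which the region takes both signs.  The two closed
    halves and the wall between them are convex, no longer two-sided at [e], and
    nonempty: the wall by elimination. *)
Lemma convex_acyclic R : convex R -> R != set0 -> acyclic (Delta R).
Proof.
have [m] := ubnP #|[set e | two_sided R e]|; elim: m => // m IH in R *.
rewrite ltnS => Rm cR R0.
have [/forallP one|] := boolP [forall e, ~~ two_sided R e].
  have [Phi PhiR Phimax] := one_sided_max cR R0 one.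
  exact: (order_complex_cone sv_le_refl PhiR).
case/forallPn => e; rewrite negbK => e2.
have lt_m R' : R' \subset R -> ~~ two_sided R' e -> #|[set v | two_sided R' v]| < m.
  move=> sub one; apply: leq_trans Rm; apply: proper_card; apply/properP; split.
    apply/subsetP => v; rewrite !inE.
    move=> /andP[/exists_inP[Phi PhiR Phiv] /exists_inP[Psi PsiR Psiv]].
    by apply/andP; split; apply/exists_inP; [exists Phi|exists Psi]; rewrite ?(subsetP sub).
  by exists e; rewrite !inE.
have oneP R' : R' \subset nonneg e -> ~~ two_sided R' e.
  move=> sub; apply/negP => /andP[_ /exists_inP[Phi /(subsetP sub)]].
  by rewrite inE => /negPf ->.
have oneN R' : R' \subset nonpos e -> ~~ two_sided R' e.
  move=> sub; apply/negP => /andP[/exists_inP[Phi /(subsetP sub) PhiN Phie] _].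
  move: PhiN Phie.
  by rewrite inE => /negPf ->.
have /andP[/exists_inP[Pi PiR /eqP Pie] /exists_inP[Xi XiR /eqP Xie]] := e2.
have [Theta [ThR The _]] := cR.2 _ _ _ PiR XiR Pie Xie.
have RE : R = (R :&: nonneg e) :|: (R :&: nonpos e).
  by apply/setP=> Phi; rewrite !inE -andb_orr; case: (Phi e); rewrite ?andbT.
rewrite RE order_complexU; first last.
- move=> x y /setIP[_ xe] yR yx; rewrite -RE in yR.
  by rewrite inE yR (nonpos_down xe).
- move=> x y /setIP[_ xe] yR yx; rewrite -RE in yR.
  by rewrite inE yR (nonneg_down xe).
- exact: sv_le_trans.
- exact: sv_le_refl.
apply: acyclic_union; rewrite -?order_complexI; try exact: order_complex_complex.
- apply: IH; [|exact: convex_nonneg|by apply/set0Pn; exists Pi; rewrite !inE PiR Pie].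
  exact: (lt_m _ (subsetIl _ _) (oneP _ (subsetIr _ _))).
- apply: IH; [|exact: convex_nonpos|by apply/set0Pn; exists Xi; rewrite !inE XiR Xie].
  exact: (lt_m _ (subsetIl _ _) (oneN _ (subsetIr _ _))).
rewrite setIACA setIid setIA.
apply: IH.
- by apply: lt_m; [rewrite -setIA subsetIl|apply: oneN; apply: subsetIr].
- exact/convex_nonpos/convex_nonneg.
- by apply/set0Pn; exists Theta; rewrite !inE ThR The.
Qed.

(** Adding the half-spaces one at a time, each new one meets the union of the
    others in a union of the same kind inside a smaller convex region; the common
    point keeps all the pieces nonempty. *)
Lemma union_acyclic R (s : seq E) : convex R ->
    (exists2 Phi : svect E, Phi \in R & {in s, forall e, Phi e != SNeg}) -> s != [::] ->
  acyclic (Delta [set Phi : svect E in R | has (fun e => Phi e != SNeg) s]).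
Proof.
elim: s R => // e s IH R cR [Phi PhiR Phis] _.
have PhiRe : Phi \in R :&: nonneg e by rewrite !inE PhiR Phis ?mem_head.
have [s0|s0] := eqVneq s [::].
  rewrite s0 (_ : [set _ in _ | _] = R :&: nonneg e); last first.
    by apply/setP=> Psi; rewrite !inE /= orbF.
  by apply: convex_acyclic; [apply: convex_nonneg|apply/set0Pn; exists Phi].
pose U := [set Psi : svect E in R | has (fun e => Psi e != SNeg) s].
have Phis' : {in s, forall v, Phi v != SNeg} by move=> v vs; rewrite Phis // inE vs orbT.
rewrite (_ : [set _ in _ | _] = (R :&: nonneg e) :|: U); last first.
  by apply/setP=> Psi; rewrite !inE /= andb_orr.
have sub : (R :&: nonneg e) :|: U \subset R.
  by apply/subsetP => Psi; rewrite !inE -andb_orr => /andP[].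
rewrite order_complexU; first last.
- move=> x y; rewrite inE => /andP[xR /hasP[v vs xv]] /(subsetP sub) yR yx.
  rewrite inE yR; apply/hasP; exists v => //.
  by have := @nonneg_down v x y; rewrite !inE; apply.
- by move=> x y /setIP[_ xe] /(subsetP sub) yR yx; rewrite inE yR (nonneg_down xe).
- exact: sv_le_trans.
- exact: sv_le_refl.
apply: acyclic_union; rewrite -?order_complexI; try exact: order_complex_complex.
- by apply: convex_acyclic; [apply: convex_nonneg|apply/set0Pn; exists Phi].
- by apply: IH => //; exists Phi.
rewrite (_ : _ :&: U = [set Psi : svect E in R :&: nonneg e | has (fun v => Psi v != SNeg) s]).
  by apply: IH => //; [apply: convex_nonneg|exists Phi].
apply/setP=> Psi; rewrite !inE; by case: (Psi \in R); rewrite /= ?andbF.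
Qed.
End SignVectorRegions.

(** * Affine covectors of an oriented matroid *)

Section OrientedMatroidRegions.
Variables (E : finType) (O : oriented_matroid E).
Local Notation Delta := (order_complex (@sv_le E)).

(** Faces of the affine arrangement that has [e0] as hyperplane at infinity. *)
Definition affine_covectors (e0 : E) : {set svect E} :=
  [set Phi : svect E in covectors O | Phi e0 == SNeg].

Lemma affine_convex e0 : convex (affine_covectors e0).
Proof.
split=> [Phi Psi|Pi Xi e].
  rewrite !inE => /andP[PhiO /eqP Phi0] /andP[PsiO _].
  by rewrite covectors_comp //= ffunE Phi0.
rewrite !inE => /andP[PiO /eqP Pi0] /andP[XiO /eqP Xi0] Pie Xie.
have [|Theta [ThO The Thw]] := @covectors_elim _ O Pi Xi e PiO XiO.
  by rewrite !inE Pie Xie.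
exists Theta; split=> //; rewrite inE ThO Thw ?ffunE ?Pi0 //.
by rewrite !inE Pi0 Xi0.
Qed.

Lemma card_chain_rank (c : {set svect E}) : c \in Delta (covectors O) ->
  sv_zero E \notin c -> #|c| <= om_rank O.
Proof.
move=> /order_complexP[cO tot] c0.
have clt : #|c| < #|covectors O|.
  apply: leq_trans (_ : #|sv_zero E |: c| <= _); first by rewrite cardsU1 c0.
  by rewrite subset_leq_card // subUset sub1set covectors0.
have := @leq_bigmax_cond _ (fun k : 'I_#|covectors O| =>
  [exists t : k.-tuple (svect E),
            all [in covectors O] t && path (@sv_lt E) (sv_zero E) t])
  (fun k => nat_of_ord k) (Ordinal clt).
apply; apply/existsP.
have sz : size (sort (@sv_le E) (enum c)) == #|c| by rewrite size_sort cardE.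
have memE Phi : (Phi \in sort (@sv_le E) (enum c)) = (Phi \in c) by rewrite mem_sort mem_enum.
exists (Tuple sz); apply/andP; split.
  by apply/allP => Phi /=; rewrite memE => /(subsetP cO).
apply: (@pairwise_sorted _ (@sv_lt E) (sv_zero E :: sort (@sv_le E) (enum c))).
rewrite pairwise_cons; apply/andP; split.
  apply/allP => Phi; rewrite memE => Phic; apply/andP; split.
    by apply: contraNneq c0 => ->.
  by apply/forallP => e; rewrite ffunE.
rewrite (_ : @sv_lt E = [rel x y | (x != y) && sv_le x y]) // pairwise_relI -uniq_pairwise.
rewrite sort_uniq enum_uniq -sorted_pairwise; last exact: sv_le_trans.
apply: (sort_sorted_in (P := mem c)) => //.
by apply/allP => Phi; rewrite mem_enum.
Qed.

End OrientedMatroidRegions.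

(** * Separation *)

Section Farkas.
Variables (E : finType) (O : oriented_matroid E).
Implicit Types (Phi Psi : svect E) (U : {set E}) (e : E).

Lemma conv_no_separation e0 U Phi : e0 \notin U -> e0 \in om_conv O U ->
  Phi \in affine_covectors O e0 -> exists2 u, u \in U & Phi u = SNeg.
Proof.
move=> e0U; rewrite !inE (negPf e0U) /= => /exists_inP[Psi].
rewrite inE => /forall_inP orth /andP[/subsetP PsiU /eqP PsiN] /andP[PhiO /eqP Phi0].
have /eqP Psi0 : Psi e0 == SNeg by have := set11 e0; rewrite -PsiN inE.
have := orth _ PhiO; rewrite /sv_orthogonal => /eqP.
have -> : [exists v, (Psi v == Phi v) && (Psi v != SZero)].
  by apply/existsP; exists e0; rewrite Psi0 Phi0.
move/esym/existsP => [u /andP[/eqP PsiPhi Psiu]]; exists u.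
  apply: PsiU; rewrite inE; case Psiu' : (Psi u) Psiu => // _.
  have : u \in sv_neg Psi by rewrite inE Psiu'.
  by rewrite PsiN inE => /eqP ue; move: PsiPhi; rewrite ue Psi0 Phi0.
case Psiu' : (Psi u) Psiu PsiPhi => // _; last by case: (Phi u).
have : u \in sv_neg Psi by rewrite inE Psiu'.
by rewrite PsiN inE => /eqP ->; rewrite Phi0.
Qed.

(** Shrink [U] to a minimal [U'] that still blocks every separating covector.  The
    sign vector that is negative at [e0] and positive on [U'] is then orthogonal
    to every covector.  Otherwise, up to a sign, some covector [Phi] is zero at
    [e0], nonnegative on [U'] and positive at some [w] in [U']; by minimality some
    [Theta] separates [e0] from [U' :\ w] and is negative at [w], and eliminating
    [w] between the two separates [e0] from [U']. *)
Lemma farkas e0 U : e0 \notin U ->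
    (forall Phi, Phi \in affine_covectors O e0 -> exists2 u, u \in U & Phi u = SNeg) ->
  e0 \in om_conv O U.
Proof.
move=> e0U noPhi.
pose P U' := [forall Phi in affine_covectors O e0, [exists u in U', Phi u == SNeg]].
have PU : P U.
  apply/forall_inP => Phi /noPhi[u uU Phiu]; apply/exists_inP; exists u => //.
  exact/eqP.
have [U' U'min U'U] := minset_exists PU.
have e0U' : e0 \notin U' by apply: contra e0U; apply: (subsetP U'U).
have PU' := minsetp U'min.
(* after reversing the sign at [e0], no nonzero nonnegative covector on
   [U'] together with [e0] *)
have key Phi : Phi \in covectors O -> Phi e0 != SPos ->
    (forall u, u \in U' -> Phi u != SNeg) ->
  forall w, (w == e0) || (w \in U') -> Phi w = SZero.
  move=> PhiO Phi0 Phige.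
  have {Phi0} Phi0 : Phi e0 = SZero.
    case Phie : (Phi e0) Phi0 => // _.
    have /(forall_inP PU')/exists_inP[u uU'] : Phi \in affine_covectors O e0.
      by rewrite inE PhiO Phie.
    by rewrite (negPf (Phige u uU')).
  move=> w /orP[/eqP -> //|wU']; case Phiw : (Phi w) (Phige w wU') => // _.
  have : ~~ P (U' :\ w).
    apply/negP => Pw; have /setP/(_ w) := minsetinf U'min Pw (subsetDl _ _).
    by rewrite !inE eqxx wU'.
  case/forall_inPn => Theta ThA; rewrite negb_exists_in => /forall_inP Thge.
  have /exists_inP[u uU' /eqP Thu] := forall_inP PU' Theta ThA.
  have uw : u = w.
    by apply/eqP; apply: contraT => uw; have := Thge u; rewrite !inE uw uU' Thu => /(_ isT).
  move: ThA; rewrite inE => /andP[ThO /eqP Th0]; rewrite {}uw in Thu.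
  have [|Xi [XiO Xiw XiE]] := @covectors_elim _ O Phi Theta w PhiO ThO.
    by rewrite !inE Phiw Thu.
  have /(forall_inP PU')/exists_inP[v vU'] : Xi \in affine_covectors O e0.
    rewrite inE XiO XiE ?ffunE ?Phi0 ?Th0 //.
    by rewrite !inE Phi0 Th0.
  have [-> | vw] := eqVneq v w; first by rewrite Xiw.
  have Thv : Theta v != SNeg by apply: Thge; rewrite !inE vw.
  rewrite XiE ?ffunE; first by case: ifP; rewrite ?(negPf Thv) // (negPf (Phige v vU')).
  by rewrite !inE (negPf (Phige v vU')) (negPf Thv) andbF.
pose Psi : svect E := [ffun e => if e == e0 then SNeg else if e \in U' then SPos else SZero].
have Psi0 : Psi e0 = SNeg by rewrite ffunE eqxx.
have PsiU u : u \in U' -> Psi u = SPos.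
  by move=> uU'; rewrite ffunE uU'; case: eqP => // ue; rewrite ue (negPf e0U') in uU'.
have Psiz w : Psi w != SZero -> (w == e0) || (w \in U').
  by rewrite ffunE; case: (eqVneq w e0) => //= _; case: ifP.
rewrite !inE e0U /=; apply/orP; right; apply/exists_inP; exists Psi; last first.
  apply/andP; split.
    apply/subsetP => w; rewrite inE ffunE; case: (eqVneq w e0) => // _; case: ifP => // wU' _.
    exact: (subsetP U'U).
  apply/eqP/setP => w; rewrite !inE ffunE; case: (eqVneq w e0) => // _.
  by case: ifP.
rewrite inE; apply/forall_inP => Phi PhiO; apply/eqP; apply/existsP/existsP.
  case=> v /andP[/eqP vE vz]; apply/existsP; apply: contraT; rewrite negb_exists => /forallP no.
  move: (vz); rewrite vE key ?Psiz //.
    by have := no e0; rewrite Psi0; case: (Phi e0).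
  by move=> u uU'; have := no u; rewrite PsiU //; case: (Phi u).
case=> v /andP[/eqP vE vz]; apply/existsP; apply: contraT; rewrite negb_exists => /forallP no.
have := @key (sv_opp Phi); rewrite covectors_opp => /(_ PhiO) keyN.
move: (vz); rewrite vE; have := keyN _ _ v (Psiz v vz); rewrite !ffunE => -> //.
  by have := no e0; rewrite Psi0; case: (Phi e0).
by move=> u uU'; have := no u; rewrite PsiU // ffunE; case: (Phi u).
Qed.

End Farkas.

(** * The intersection of the two structures *)

Section Separation.
Variables (V : finType) (O : oriented_matroid (option V)) (M : matroid V).
Local Notation Delta := (order_complex (@sv_le (option V))).
Local Notation Q := (affine_covectors O None).

Definition neg_part (Phi : svect (option V)) : {set V} := [set v | Phi (Some v) == SNeg].

Definition neg_support (c : {set svect (option V)}) : {set V} := \bigcup_(Phi in c) neg_part Phi.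

Definition meets_nonneg (S : {set V}) : {set svect (option V)} :=
  [set Phi : svect (option V) in Q | ~~ (S \subset neg_part Phi)].

Definition indep_in (W : {set V}) : {set {set V}} := [set S in indep M | S \subset W].

(** Negative parts increase along a chain, so the top covector collects them all. *)
Lemma neg_support_chain (c : {set svect (option V)}) (S : {set V}) :
  c \in Delta Q -> c != set0 -> S \subset neg_support c ->
  exists2 Phi, Phi \in c & S \subset neg_part Phi.
Proof.
move=> cD c0 /subsetP Sc.
have [Phi Phic Phimax] := chain_has_max (@sv_le_refl _) (@sv_le_trans _) cD c0.
exists Phi => //; apply/subsetP => v /Sc /bigcupP[Psi Psic].
rewrite !inE => /eqP Psiv; have /forallP/(_ (Some v)) := Phimax _ Psic.
by rewrite /sign_le Psiv /= eq_sym.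
Qed.

Lemma matroid_rank_witness (W : {set V}) d : 0 < d <= matroid_rank M W ->
  exists2 B, B \in indep_in W & (d <= #|B|).
Proof.
case: d => // d; rewrite /matroid_rank => dM.
apply/exists_inP; apply: contraLR dM; rewrite negb_exists_in -leqNgt => /forall_inP small.
apply/bigmax_leqP => S /andP[SM SW].
by have := small S; rewrite !inE SM SW -leqNgt => /(_ isT).
Qed.

Lemma matroid_rankS (W W' : {set V}) :
  W \subset W' -> matroid_rank M W <= matroid_rank M W'.
Proof.
move=> WW'; apply/bigmax_leqP => S /andP[SM SW].
by apply: (@leq_bigmax_cond _ _ (fun S : {set V} => #|S|)); rewrite SM (subset_trans SW).
Qed.

Lemma indep_in_exact (W : {set V}) n : n < matroid_rank M W -> exact_at (indep_in W) n.
Proof.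
move=> nW; have [B BW nB] := @matroid_rank_witness W n.+1 nW.
apply: (@matroid_exact _ _ B) => //.
  move=> S S' SS'; rewrite !inE => /andP[S'M S'W].
  by rewrite (indep_sub SS' S'M) (subset_trans SS').
move=> S S'; rewrite !inE => /andP[SM SW] /andP[S'M S'W] ltS.
have [v vS vM] := indep_exchange SM S'M ltS; exists v => //.
rewrite !inE vM subUset SW sub1set andbT.
by move: vS; rewrite inE => /andP[_]; apply: (subsetP S'W).
Qed.

Lemma meets_nonneg_acyclic (S : {set V}) : S != set0 ->
    (exists2 Phi, Phi \in Q & {in S, forall v, Phi (Some v) != SNeg}) ->
  acyclic (Delta (meets_nonneg S)).
Proof.
move=> S0 [Phi PhiQ Phige].
rewrite (_ : meets_nonneg S =
  [set Psi : svect (option V) in Q | has (fun e => Psi e != SNeg) [seq Some v | v <- enum S]]).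
  apply: union_acyclic; first exact: affine_convex.
    by exists Phi => // _ /mapP[v + ->]; rewrite mem_enum => /Phige.
  case: (enum S) (mem_enum S) => // /(_ _) eS.
  by case/set0Pn: S0 => v; rewrite -eS.
apply/setP=> Psi; rewrite !inE; congr (_ && _); rewrite has_map.
apply/subsetPn/hasP => -[v vS]; rewrite ?inE => Psiv; exists v; rewrite ?inE //.
  by rewrite mem_enum.
by rewrite mem_enum in vS.
Qed.

Lemma card_affine_chain c : c \in Delta Q -> #|c| <= om_rank O.
Proof.
move=> cD; apply: card_chain_rank.
  apply: (subsetP (order_complexS _ _)) cD.
  by apply/subsetP => Phi; rewrite inE => /andP[].
apply/negP => c0; case/order_complexP: cD => /subsetP/(_ _ c0).
by rewrite inE ffunE andbF.
Qed.

Lemma order_complex0 (R : {set svect (option V)}) : set0 \in Delta R.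
Proof. by apply/order_complexP; split; [apply: sub0set|move=> x y; rewrite inE]. Qed.

(** The coincidence produced by the two carriers is a chain of covectors, none of
    which is negative on all of [S], whose top covector is negative on [S]. *)
Lemma rank_separation_absurd :
    (forall Phi, Phi \in Q -> om_rank O <= matroid_rank M (neg_part Phi)) ->
    (forall S, S \in indep M ->
      exists2 Phi, Phi \in Q & {in S, forall v, Phi (Some v) != SNeg}) ->
  False.
Proof.
move=> rankQ sepM.
have subM (S S' : {set V}) : S \subset S' -> S' \in indep M -> S \in indep M.
  exact: indep_sub.
have cxM W : complex (indep_in W).
  move=> S v; rewrite !inE => /andP[SM SW].
  by rewrite (subM _ _ (subsetDl _ _) SM) (subset_trans (subsetDl _ _) SW).
have [c [S [cQ c0]]] : exists c S, [/\ c \in Delta Q, c != set0,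
    S \in indep_in (neg_support c) & c \in Delta (meets_nonneg S)].
  apply: (@carrier_coincidence _ _ (Delta Q) (indep_in setT)
            (fun c => indep_in (neg_support c)) (fun S => Delta (meets_nonneg S))) => //.
  - exact: order_complex_complex.
  - exact: order_complex0.
  - apply: convex_acyclic; first exact: affine_convex.
    case/set0Pn: (indep_nonempty M) => S /sepM[Phi PhiQ _].
    by apply/set0Pn; exists Phi.
  - by move=> c _; apply/subsetP => S; rewrite !inE => /andP[->]; rewrite subsetT.
  - move=> c Phi _; apply/subsetP => S; rewrite !inE => /andP[-> SW] /=.
    by apply: subset_trans SW _; apply/bigcupsP => Psi /setD1P[_]; apply: bigcup_sup.
  - have /set0Pn[S SM] := indep_nonempty M.
    by rewrite inE sub0set (subM _ _ (sub0set S) SM).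
  - move=> c n cD cn; apply: indep_in_exact.
    have /set0Pn[Phi Phic] : c != set0 by rewrite -card_gt0 cn.
    have /order_complexP[/subsetP/(_ _ Phic) PhiQ _] := cD.
    have := card_affine_chain cD; rewrite cn => /leq_trans; apply.
    exact: leq_trans (rankQ _ PhiQ) (matroid_rankS (bigcup_sup _ Phic)).
  - by move=> S _; apply: order_complexS; apply/subsetP => Phi; rewrite inE => /andP[].
  - move=> S v _; apply: order_complexS; apply/subsetP => Phi.
    rewrite !inE => /andP[-> /=]; apply: contra; apply: subset_trans; exact: subsetDl.
  - exact: order_complex0.
  - by move=> S; rewrite inE => /andP[SM _] S0; apply: meets_nonneg_acyclic; last exact: sepM.
rewrite inE => /andP[_ Sc] /order_complexP[/subsetP cS _].
have [Phi Phic SPhi] := neg_support_chain cQ c0 Sc.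
by have := cS _ Phic; rewrite inE SPhi andbF.
Qed.

End Separation.

(* The set of elements V + {v0} is option V: v0 is None, and U : {set V} is
   viewed inside it as Some @: U. *)
Theorem theorem1p8 (V : finType) (d : nat) (O : oriented_matroid (option V))
    (rank_le : om_rank O <= d) (M : matroid V)
    (conv_v0 : forall U : {set V},
       matroid_rank M (~: U) < d -> None \in om_conv O (Some @: U)) :
  exists U' : {set V}, U' \in indep M /\ None \in om_conv O (Some @: U').
Proof.
have None_out (U : {set V}) : None \notin Some @: U by apply/imsetP => -[].
have [/exists_inP[U UM Uconv]|] := boolP [exists U in indep M, None \in om_conv O (Some @: U)].
  by exists U.
rewrite negb_exists_in => /forall_inP noU.
exfalso; apply: (@rank_separation_absurd V O M) => [Phi PhiQ|S SM].
  apply: leq_trans rank_le _; rewrite leqNgt; apply/negP => small.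
  have [|_ /imsetP[u + ->]] := conv_no_separation (None_out (~: neg_part Phi)) _ PhiQ.
    by apply: conv_v0; rewrite setCK.
  by rewrite !inE => /eqP.
have [/exists_inP[Phi PhiQ /forall_inP Phige]|] :=
    boolP [exists Phi in affine_covectors O None, [forall v in S, Phi (Some v) != SNeg]].
  by exists Phi.
rewrite negb_exists_in => /forall_inP no.
case/negP: (noU S SM); apply: farkas => // Phi /no.
case/forall_inPn => v vS; rewrite negbK => /eqP Phiv.
by exists (Some v) => //; apply: imset_f.
Qed.
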